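(* Let $a,y$ be real numbers. If $0<y<1$ and $a\geq 2$, then $$B(a,y)\geq \frac{1}{8\ln\left(\frac{3}{2}\right)}\left(\frac{5}{9}\right)^{y}\left(\frac{4}{9}\right)^{a-1}\frac{(a+y)(a+y+1)}{ay}.$$
   Context: For real $x,y>0$, $B(x,y)=\int_0^1 t^{x-1}(1-t)^{y-1}\,dt$ denotes the (Euler) beta function. *)

(* Defs.v *)
From mathcomp Require Import all_boot all_order all_algebra.
From mathcomp Require Import all_classical all_reals all_analysis.
Set Implicit Arguments.
Unset Strict Implicit.
Unset Printing Implicit Defensive.
Import Order.TTheory GRing.Theory Num.Theory.
Import numFieldNormedType.Exports.
Local Open Scope classical_set_scope.
Local Open Scope ring_scope.

(* Intended for x, y > 0, where the integral is finite.  [beta_fun] from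
   MathComp-Analysis covers only natural-number arguments.  The endpoints, a
   null set, are left out because there the base of a possibly negative power
   vanishes and [powR] returns a conventional value. *)
Definition euler_beta (R : realType) (x y : R) : R :=
  \int[@lebesgue_measure R]_(t in `]0, 1[) (t `^ (x - 1) * (1 - t) `^ (y - 1)).

(* Main.v *)
Require Import Defs.
From mathcomp Require Import all_boot all_order all_algebra.
From mathcomp Require Import all_classical all_reals all_analysis.
From mathcomp Require Import measurable_realfun ring lra.
Set Implicit Arguments.
Unset Strict Implicit.
Unset Printing Implicit Defensive.
Import Order.TTheory GRing.Theory Num.Theory.
Import numFieldNormedType.Exports.
Local Open Scope classical_set_scope.
Local Open Scope ring_scope.

(** Put r = a - 2. The tangent-line bound w^r >= 1 + r (1 - 1/w) at w = 2t gives
    t^(a-1) >= (1/2)^r (1 + r/2 - (1 + r)(1 - t)). Multiplying by (1-t)^(y-1)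
    and integrating, with int_0^1 (1-t)^(p-1) dt = 1/p for p = y and p = y + 1,
    yields B(a,y) >= (1/2)^r (1 + r(1-y)/2) / (y(y+1)). With
    (9/8)^r >= (1 + r/18)^2, (5/9)^y <= 1 - 4y/9 and ln(3/2) >= 2/5, the claim
    becomes a polynomial inequality in r >= 0 and 0 < y < 1. *)

(** * Elementary bounds on real powers and logarithms *)

Lemma powR_ge1Dln (R : realType) (w r : R) : 0 < w -> 1 + r * ln w <= w `^ r.
Proof. by move=> w0; rewrite /powR gt_eqF//; exact: expR_ge1Dx. Qed.

Lemma ln_leB1 (R : realType) (x : R) : 0 < x -> ln x <= x - 1.
Proof.
move=> x0; have := @le_ln1Dx R (x - 1); rewrite [1 + _]addrC subrK; apply.
by rewrite ltrBrDr addNr.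
Qed.

(** Since ln (1/w) <= 1/w - 1, ln w >= 1 - 1/w, and exp x >= 1 + x does the rest. *)
Lemma powR_ge1DV (R : realType) (w r : R) : 0 < w -> 0 <= r ->
  1 + r * (1 - w^-1) <= w `^ r.
Proof.
move=> w0 r0; apply: le_trans (powR_ge1Dln r w0).
rewrite lerD2l ler_wpM2l// -lerN2 -lnV ?posrE// opprB.
by apply: ln_leB1; rewrite invr_gt0.
Qed.

(** Weighted AM-GM for w and 1 with mean m: averaging ln x <= x - 1 at w/m and 1/m with weights y
    and 1 - y gives y ln w - ln m <= 0. *)
Lemma powR_le_chord (R : realType) (w y : R) : 0 < w -> 0 <= y <= 1 ->
  w `^ y <= 1 + y * (w - 1).
Proof.
move=> w0 /andP[y0 y1]; set m := 1 + _.
have m0 : 0 < m by rewrite /m; nra.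
rewrite /powR gt_eqF// -[leRHS]lnK ?posrE// ler_expR.
have m1 : 0 < m^-1 by rewrite invr_gt0.
have h1 := ln_leB1 (divr_gt0 w0 m0).
have h2 := ln_leB1 m1.
rewrite ln_div ?posrE// in h1; rewrite lnV ?posrE// in h2.
have e : y * (w / m) + (1 - y) * m^-1 = 1.
  by rewrite mulrA -mulrDl (_ : _ + _ = m) ?divff ?gt_eqF// /m; ring.
nra.
Qed.

Lemma ln3_2_ge (R : realType) : 2 / 5 <= ln (3 / 2) :> R.
Proof.
rewrite -[leLHS]expRK ler_ln ?posrE ?expR_gt0 //.
(* ln (3/2) >= 2/5 means exp (-2/5) >= 2/3, and (39/40)^16 > 2/3. *)
have h : 39 / 40 <= expR (- (1 / 40)) :> R.
  by apply: le_trans (expR_ge1Dx _); lra.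
have -> : 2 / 5 = - (- (1 / 40) * 16%:R) :> R by field.
rewrite expRN expRM_natr.
have : (2 / 3) <= expR (- (1 / 40)) ^+ 16 :> R.
  apply: le_trans (lerXn2r 16 _ _ h); rewrite ?nnegrE ?expR_ge0//.
  lra.
move=> k; rewrite invf_ple ?posrE ?exprn_gt0 ?expR_gt0//.
by rewrite invf_div.
Qed.

(** What remains of the claim for a = r + 2 once the transcendental factors are bounded. The
    constant 5/36 is 5/16, an upper bound of 1 / (8 ln (3/2)), times the 4/9 left over from
    (4/9)^(r+1). *)
Lemma beta_bound_poly (R : realType) (r y : R) : 0 <= r -> 0 < y -> y < 1 ->
  5 / 36 * (1 - 4 / 9 * y) * ((r + 2 + y) * (r + 2 + y + 1)) * (y + 1) <=
  (1 + r / 18) ^+ 2 * (1 + r * (1 - y) / 2) * (r + 2).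
Proof.
move=> r0 y0 y1.
set z := 1 - y.
have z0 : 0 < z by rewrite subr_gt0.
have z1 : z < 1 by rewrite /z; lra.
have -> : y = 1 - z by rewrite /z; ring.
rewrite -subr_ge0.
(* All terms of this expansion in [z = 1 - y] are visibly nonnegative. *)
have -> : (1 + r / 18) ^+ 2 * (1 + r * z / 2) * (r + 2) -
    5 / 36 * (1 - 4 / 9 * (1 - z)) *
      ((r + 2 + (1 - z)) * (r + 2 + (1 - z) + 1)) * (1 - z + 1) =
    4 / 27 + r * ((46 - 12 * r + r ^+ 2) / 324)
    + z * (85 / 162 + z * ((295 - 155 * z) / 324) + 5 / 81 * z ^+ 3)
    + r * z * ((319 + z * (170 - 40 * z)) / 324)
    + r ^+ 2 * z * ((183 + 20 * z) / 324) + r ^+ 3 * z * (19 / 324)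
    + r ^+ 4 * z / 648.
  by field.
clearbody z; have q0 : 0 <= (46 - 12 * r + r ^+ 2) / 324.
  (* 46 - 12 r + r^2 = (r - 6)^2 + 10. *)
  by have := sqr_ge0 (r - 6); lra.
have q1 : 0 <= (295 - 155 * z) / 324 by lra.
have q2 : 0 <= (170 - 40 * z) / 324 by lra.
have -> : (319 + z * (170 - 40 * z)) / 324 =
  319 / 324 + z * ((170 - 40 * z) / 324) by field.
move: q0 q1 q2.
set A := (46 - _ + _) / 324; set B := (295 - _) / 324; set C := (170 - _) / 324.
have z0' := ltW z0; clearbody A B C => A0 B0 C0.
have t1 : 0 <= r * A by exact: mulr_ge0.
have t2 : 0 <= z * (85 / 162 + z * B + 5 / 81 * z ^+ 3).
  apply: mulr_ge0 => //; have := mulr_ge0 z0' B0; have := exprn_ge0 3 z0'.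
  lra.
have t3 : 0 <= r * z * (319 / 324 + z * C).
  apply: mulr_ge0; first exact: mulr_ge0.
  by have := mulr_ge0 z0' C0; lra.
have t4 : 0 <= r ^+ 2 * z * ((183 + 20 * z) / 324).
  by apply: mulr_ge0; [rewrite mulr_ge0 ?exprn_ge0 | lra].
have t5 : 0 <= r ^+ 3 * z by rewrite mulr_ge0 ?exprn_ge0.
have t6 : 0 <= r ^+ 4 * z by rewrite mulr_ge0 ?exprn_ge0.
lra.
Qed.

(** * Integrals of powers of 1 - t *)

Lemma is_derive_powR_onem (R : realType) (p x : R) : x < 1 ->
  is_derive x 1 (fun t : R => (1 - t) `^ p) (- (p * (1 - x) `^ (p - 1))).
Proof.
move=> x1.
have d1 : is_derive x 1 (fun t : R => 1 - t) (- 1).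
  by apply: is_derive_eq; rewrite add0r mul1r.
have d2 : is_derive (1 - x) 1 (fun u : R => u `^ p) (p * (1 - x) `^ (p - 1)).
  by apply: is_derive1_powR; rewrite subr_gt0.
have d3 := @is_derive1_comp R (fun u : R => u `^ p)
  (fun t : R => 1 - t) x _ _ d2 d1.
by apply: (is_derive_eq d3); rewrite mulrN1.
Qed.

Lemma measurable_powR_onem (R : realType) (p : R) (D : set R) :
  measurable_fun D (fun t : R => (1 - t) `^ p).
Proof.
apply: measurable_funTS.
apply: (@measurableT_comp _ _ _ _ _ _ (@powR R ^~ p)) => //.
by apply: measurable_funB.
Qed.

(** For p < 1 the integrand blows up at 1, so the fundamental theorem is applied on segments
    [0, b n] and monotone convergence passes to the limit. *)
Lemma integral_powR_onem (R : realType) (p : R) : 0 < p ->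
  (\int[@lebesgue_measure R]_(t in `]0%R, 1%R[) ((1 - t) `^ (p - 1))%:E
   = (p^-1)%:E)%E.
Proof.
move=> p0.
have p_neq0 : p != 0 by rewrite gt_eqF.
(* Here b n = 1 - 1/(n+2); the shift by one keeps b 0 > 0, so no segment is degenerate. *)
pose b n : R := 1 - (harmonic n.+1 : R).
have b_gt0 n : 0 < b n by rewrite /b /harmonic/= subr_gt0 invf_lt1// ltr1n.
have b_lt1 n : b n < 1 by rewrite /b /harmonic/= gtrBl invr_gt0.
have b_ndecr m n : (m <= n)%N -> b m <= b n.
  by move=> mn; rewrite /b /harmonic/= lerD2l lerN2 lef_pV2 ?posrE// ler_nat.
have part n :
    (\int[@lebesgue_measure R]_(t in `[0%R, b n]) ((1 - t) `^ (p - 1))%:E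
    = (p^-1 * (1 - harmonic n.+1 `^ p))%:E)%E.
  pose F : R -> R := fun t => - (p^-1) * (1 - t) `^ p.
  have dF (x : R) : x < 1 -> is_derive x 1 F ((1 - x) `^ (p - 1)).
    move=> x1; have := is_derive_powR_onem p x1 => d.
    rewrite /F; apply: is_derive_eq.
    by rewrite /GRing.scale/= mulrN mulNr opprK mulrA mulVf ?mul1r.
  rewrite (@continuous_FTC2 _ _ F)//.
  - rewrite /F subr0 powR1 /b subKr.
    by rewrite -EFinB; congr EFin; ring.
  - apply: derivable_within_continuous => x; rewrite in_itv/= => /andP[_ xb].
    have := is_derive_powR_onem (p - 1) (le_lt_trans xb (b_lt1 n)).
    by case.
  - have cF : {within `[0, b n], continuous F}.
      apply: derivable_within_continuous => x; rewrite in_itv/= => /andP[_ xb].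
      by have [] := dF _ (le_lt_trans xb (b_lt1 n)).
    have /(continuous_within_itvP _ (b_gt0 n))[_ ? ?] := cF.
    split => // x; rewrite in_itv/= => /andP[_ xb].
    by have [] := dF _ (lt_trans xb (b_lt1 n)).
  - move=> x; rewrite in_itv/= => /andP[_ xb].
    by rewrite derive1E; have [_ ->] := dF _ (lt_trans xb (b_lt1 n)).
have bU : \bigcup_n [set` `[0, b n]] = `[0%R, 1%R[%classic :> set R.
  apply/seteqP; split => x /=.
    move=> [n _] /=; rewrite !in_itv/= => /andP[-> xb].
    exact: le_lt_trans xb (b_lt1 n).
  rewrite in_itv/= => /andP[x0 x1].
  have cb : b n @[n --> \oo] --> (1 : R).
    rewrite -[X in _ --> X]subr0; apply: cvgB; first exact: cvg_cst.
    by rewrite (cvg_shiftS (@harmonic R)); exact: cvg_harmonic.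
  have [N _ /(_ N (leqnn N)) xb] := cvgr_gt _ cb _ x1.
  by exists N => //=; rewrite in_itv/= x0 ltW.
(* The null point 0 is added, since the segments contain it. *)
rewrite -(@integral_itv_bndoo _ 0 1 _ true true); last first.
  by apply/measurable_EFinP; apply: measurable_powR_onem.
have : (\int[@lebesgue_measure R]_(t in `[0%R, b n]) ((1 - t) `^ (p - 1))%:E
    @[n --> \oo] -->
    \int[@lebesgue_measure R]_(t in `[0%R, 1%R[) ((1 - t) `^ (p - 1))%:E)%E.
  rewrite -bU; apply: ge0_nondecreasing_set_cvg_integral => //.
  - apply/nondecreasing_seqP => n; rewrite subsetEset => x /=.
    rewrite !in_itv/= => /andP[-> xb].
    exact: le_trans xb (b_ndecr _ _ (leqnSn n)).
  - by move=> n; apply/measurable_EFinP; apply: measurable_powR_onem.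
  - by move=> n x _; rewrite lee_fin powR_ge0.
under eq_fun do rewrite part.
move/cvg_lim => <- //; apply/cvg_lim => //.
apply: cvg_EFin; first exact: nearW.
rewrite -[X in _ --> X]mulr1; apply: cvgMr.
rewrite -[X in _ --> X]subr0; apply: cvgB; first exact: cvg_cst.
rewrite (cvg_shiftS (fun n => @harmonic R n `^ p)).
(* As p > 0, x^p tends to 0 at 0+, here along the harmonic sequence. *)
have /cvg_at_rightP := powR_cvg0 p0; apply; split => [n|].
  exact: harmonic_gt0.
exact: cvg_harmonic.
Qed.

Lemma integrable_powR_onem (R : realType) (p : R) : 0 < p ->
  (@lebesgue_measure R).-integrable `]0%R, 1%R[
    (EFin \o (fun t : R => (1 - t) `^ (p - 1))).
Proof.
move=> p0; apply/integrableP; split.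
  by apply/measurable_EFinP; apply: measurable_powR_onem.
under eq_integral do rewrite /= ger0_norm ?powR_ge0//.
by rewrite integral_powR_onem// ltry.
Qed.

Lemma Rintegral_powR_onem (R : realType) (p : R) : 0 < p ->
  \int[@lebesgue_measure R]_(t in `]0, 1[) ((1 - t) `^ (p - 1)) = p^-1.
Proof. by move=> p0; rewrite /Rintegral integral_powR_onem. Qed.

(** * The lower bound for the beta function and its comparison with the claim *)

Lemma euler_beta_ge (R : realType) (a y : R) : 2 <= a -> 0 < y ->
  (1 / 2) `^ (a - 2) * ((1 + (a - 2) / 2) / y - (1 + (a - 2)) / (y + 1)) <=
  euler_beta a y.
Proof.
move=> a2 y0; set r := a - 2.
have r0 : 0 <= r by rewrite subr_ge0.
have y10 : 0 < y + 1 by rewrite addr_gt0.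
set c := (1 / 2) `^ r.
have c0 : 0 <= c by exact: powR_ge0.
pose g (p : R) (t : R) : R := (1 - t) `^ (p - 1).
have mD : measurable (`]0%R, 1%R[%classic : set (measurableTypeR R)) by [].
have ig p k : 0 < p ->
    (@lebesgue_measure R).-integrable `]0%R, 1%R[ (EFin \o (fun t => k * g p t)).
  by move=> p0; exact: (integrableZl mD k (integrable_powR_onem p0)).
have -> : c * ((1 + r / 2) / y - (1 + r) / (y + 1)) =
    \int[@lebesgue_measure R]_(t in `]0, 1[)
      (c * (1 + r / 2) * g y t - c * (1 + r) * g (y + 1) t).
  rewrite RintegralB ?RintegralZl//; try exact: ig;
    try exact: integrable_powR_onem.
  by rewrite !Rintegral_powR_onem//; ring.
apply: le_Rintegral => //.
- exact: (integrableB mD (ig _ _ y0) (ig _ _ y10)).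
(* The beta integrand is dominated by (1-t)^(y-1), because t^(a-1) <= t^0 = 1. *)
- apply: (le_integrable mD _ _ (integrable_powR_onem y0)).
    apply/measurable_EFinP; apply: measurable_funM.
      by apply: measurable_funTS; exact: measurable_powR.
    exact: measurable_powR_onem.
  move=> t /=; rewrite in_itv/= => /andP[t0 t1]; rewrite lee_fin.
  rewrite !ger0_norm ?mulr_ge0 ?powR_ge0//.
  rewrite ler_piMl ?powR_ge0// -[leRHS](powRr0 t); apply: ger_powR; last by lra.
  by rewrite t0 ltW.
move=> t /=; rewrite in_itv/= => /andP[t0 t1]; rewrite /g.
have s0 : 0 < 1 - t by rewrite subr_gt0.
(* Writing (1-t)^y as (1-t) (1-t)^(y-1) exposes the common factor to cancel. *)
rewrite addrK -(mulr_powRB1 (ltW s0) y0) mulrA -mulrBl.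
rewrite ler_wpM2r ?powR_ge0//.
have -> : a - 1 = r + 1 by rewrite /r; ring.
rewrite powRD ?(gt_eqF t0) ?implybT// powRr1 ?(ltW t0)//.
have w0 : 0 < 2 * t by rewrite mulr_gt0.
have -> : t `^ r = c * (2 * t) `^ r.
  by rewrite -powRM ?(ltW w0)//; congr (_ `^ _); field.
rewrite -[leRHS]mulrA.
apply: le_trans (ler_wpM2l c0 (ler_wpM2r (ltW t0) (powR_ge1DV w0 r0))).
(* The factor t clears the 1/(2t): t (1 + r (1 - 1/(2t))) equals 1 + r/2 - (1 + r) (1 - t). *)
by rewrite le_eqVlt; apply/orP; left; apply/eqP; field; rewrite gt_eqF.
Qed.

Theorem corollary2p18 (R : realType) (a y : R) (hy0 : 0 < y) (hy1 : y < 1)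
    (ha : 2 <= a) :
  euler_beta a y >=
    1 / (8 * ln (3 / 2)) * (5 / 9) `^ y * (4 / 9) `^ (a - 1)
      * ((a + y) * (a + y + 1) / (a * y)).
Proof.
apply: le_trans (euler_beta_ge ha hy0); set r := a - 2.
have r0 : 0 <= r by rewrite subr_ge0.
have a0 : 0 < a by lra.
have -> : a = r + 2 by rewrite /r; ring.
have -> : r + 2 - 1 = r + 1 by ring.
have n49 : 4 / 9 != 0 :> R by rewrite gt_eqF//; lra.
rewrite powRD ?n49 ?implybT// powRr1//.
(* This splits off the power (4/9)^r that the claim also contains. *)
have -> : (1 / 2) `^ r = (4 / 9) `^ r * (9 / 8) `^ r.
  by rewrite -powRM//; congr (_ `^ _); field.
set q := (4 / 9) `^ r; have q0 : 0 <= q by exact: powR_ge0.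
set e := (9 / 8) `^ r.
(* The tangent bound is taken at exponent r/2 and squared: the linear bound 1 + r/9 would fail for
   large r and y near 1, where r^2/9 falls below 25 r^2/162. *)
have e1 : (1 + r / 18) ^+ 2 <= e.
  have h : 1 + r / 18 <= (9 / 8) `^ (r / 2).
    apply: le_trans (powR_ge1DV _ _); lra.
  have -> : e = ((9 / 8) `^ (r / 2)) ^+ 2.
    by rewrite -powR_mulrn ?powR_ge0// -powRrM; congr (_ `^ _); field.
  by rewrite ler_sqr ?nnegrE ?powR_ge0//; lra.
set u := (5 / 9) `^ y.
have u1 : u <= 1 - 4 / 9 * y.
  have := @powR_le_chord R (5 / 9) y; rewrite -/u; lra.
have u0 : 0 <= u by exact: powR_ge0.
have l1 : 1 / (8 * ln (3 / 2)) <= 5 / 16 :> R.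
  have := ln3_2_ge R => l.
  by rewrite ler_pdivrMr; lra.
set k := 1 / _ in l1 *.
have k0 : 0 <= k by rewrite /k mul1r invr_ge0; have := ln3_2_ge R; lra.
have r2 : 0 < r + 2 by lra.
set X := (r + 2 + y) * (r + 2 + y + 1).
have X0 : 0 <= X by rewrite mulr_ge0; lra.
(* Both sides get the same nonnegative prefactor, which is then cancelled. *)
have -> : k * u * (q * (4 / 9)) * (X / ((r + 2) * y)) =
    q / ((r + 2) * y * (y + 1)) * (4 / 9 * (k * u) * X * (y + 1)).
  by field; rewrite !gt_eqF//; lra.
have -> : q * e * ((1 + r / 2) / y - (1 + r) / (y + 1)) =
    q / ((r + 2) * y * (y + 1)) * (e * (1 + r * (1 - y) / 2) * (r + 2)).
  by field; rewrite !gt_eqF//; lra.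
apply: ler_wpM2l.
  by rewrite divr_ge0// !mulr_ge0//; lra.
have y1 : 0 <= y + 1 by lra.
have h : 0 <= 1 + r * (1 - y) / 2.
  by rewrite addr_ge0// divr_ge0// mulr_ge0// subr_ge0 ltW.
(* The bounds on [k] and [u] enter on the left, the one on [e] on the right. *)
apply: le_trans (le_trans (beta_bound_poly r0 hy0 hy1) _).
  rewrite -/X !ler_wpM2r//.
  have : k * u <= 5 / 16 * (1 - 4 / 9 * y) by exact: ler_pM.
  lra.
by rewrite !ler_wpM2r// ltW.
Qed.
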